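(* Let $m,n$ be positive integers, $N:=\{1,\dots,n\}$, $v_1,\dots,v_n\in\mathbb{R}^m$ such that the $n\times m$ matrix $A:=(v_1,v_2,\dots,v_n)^{\mathsf T}$ has full column rank, let $l,u\in\mathbb{Z}^n$ with $0\le l<u$ (componentwise), and let $s\ge m$ be an integer with $\mathbf{e}^{\mathsf T}l\le s\le \mathbf{e}^{\mathsf T}u$. Consider the problem $$\text{(D-Opt)}\qquad \max\Big\{\operatorname{ldet}\sum_{\ell\in N}x_\ell v_\ell v_\ell^{\mathsf T}\;:\;\mathbf{e}^{\mathsf T}x=s,\ l\le x\le u,\ x\in\mathbb{Z}^n\Big\}$$ and the problem $$\text{(Dual)}\qquad \begin{array}{ll}\min & -\operatorname{ldet}\Lambda+\lambda^{\mathsf T}u-\theta^{\mathsf T}l+\nu s-m\\ \text{s.t.} & \Lambda\bullet v_iv_i^{\mathsf T}-\lambda_i+\theta_i-\nu=0,\quad i\in N,\\ & \Lambda\succ 0,\ \lambda\ge 0,\ \theta\ge 0,\end{array}$$ with variables $\Lambda$ (a symmetric $m\times m$ real matrix), $\lambda,\theta\in\mathbb{R}^n$, $\nu\in\mathbb{R}$. Let $LB\in\mathbb{R}$ be the objective-function value of a feasible solution for (D-Opt), and let $(\hat\Lambda,\hat\lambda,\hat\theta,\hat\nu)$ be a feasible solution for (Dual) with objective-function value $\hat\zeta$. Then, for every optimal solution $x^\star$ of (D-Opt), we have $$x^\star_k\le l_k+\left\lfloor \big(\hat\zeta-LB\big)/\hat\theta_k\right\rfloor\qquad\text{for all }k\in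 N\text{ such that }\hat\theta_k>0,$$ $$x^\star_k\ge u_k-\left\lfloor \big(\hat\zeta-LB\big)/\hat\lambda_k\right\rfloor\qquad\text{for all }k\in N\text{ such that }\hat\lambda_k>0.$$
   Context: Here $\operatorname{ldet}$ denotes the natural logarithm of the determinant, with the value $-\infty$ on singular positive-semidefinite matrices. $\mathbf{e}$ is the all-ones vector, so $\mathbf{e}^{\mathsf T}x=\sum_{\ell\in N}x_\ell$. Vector inequalities are componentwise. For matrices $X,Y$ of the same size, $X\bullet Y:=\operatorname{Trace}(X^{\mathsf T}Y)$. $\Lambda\succ0$ means that $\Lambda$ is symmetric positive definite. The problem (Dual) is the Lagrangian dual of the continuous relaxation of (D-Opt), obtained by replacing $x\in\mathbb{Z}^n$ with $x\in\mathbb{R}^n$. *)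

(* Defs.v *)
From mathcomp Require Import all_boot all_order all_algebra.
From mathcomp Require Import all_classical all_reals all_analysis.

Set Implicit Arguments.
Unset Strict Implicit.
Unset Printing Implicit Defensive.

Import Order.TTheory GRing.Theory Num.Theory.
Local Open Scope ring_scope.

Definition dotv (R : realType) (n : nat) (x y : 'cV[R]_n) : R :=
  \sum_(i < n) x i 0 * y i 0.

Definition mxinner (R : realType) (m n : nat) (X Y : 'M[R]_(m, n)) : R :=
  \tr (X^T *m Y).

Definition posdefmx (R : realType) (m : nat) (X : 'M[R]_m) : Prop :=
  X^T = X /\ forall z : 'cV[R]_m, z != 0 -> 0 < dotv z (X *m z).

(* [lne] is the extended-real logarithm, with [lne 0 = -oo].  Only used on
   positive semidefinite matrices, so the determinant is never negative. *)
Definition ldet (R : realType) (m : nat) (X : 'M[R]_m) : \bar R :=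
  lne (\det X)%:E.

Definition design_mx (R : realType) (m n : nat) (v : 'I_n -> 'cV[R]_m) :
  'M[R]_(n, m) := \matrix_(i < n, j < m) v i j 0.

Definition intvec (R : realType) (n : nat) (x : 'cV[int]_n) : 'cV[R]_n :=
  map_mx intr x.
Arguments intvec R {n} x.

(* Integrality is carried by the type of [x]. *)
Definition dopt_feasible (n : nat) (l u : 'cV[int]_n) (s : int)
    (x : 'cV[int]_n) : Prop :=
  \sum_(i < n) x i 0 = s /\ forall i, l i 0 <= x i 0 <= u i 0.

Definition dopt_obj (R : realType) (m n : nat) (v : 'I_n -> 'cV[R]_m)
    (x : 'cV[int]_n) : \bar R :=
  ldet (\sum_(i < n) (x i 0)%:~R *: (v i *m (v i)^T)).

Definition dopt_optimal (R : realType) (m n : nat) (v : 'I_n -> 'cV[R]_m)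
    (l u : 'cV[int]_n) (s : int) (x : 'cV[int]_n) : Prop :=
  dopt_feasible l u s x /\
  forall y, dopt_feasible l u s y -> (dopt_obj v y <= dopt_obj v x)%E.

Definition dual_feasible (R : realType) (m n : nat) (v : 'I_n -> 'cV[R]_m)
    (Lambda : 'M[R]_m) (lambda theta : 'cV[R]_n) (nu : R) : Prop :=
  [/\ forall i, mxinner Lambda (v i *m (v i)^T)
                  - lambda i 0 + theta i 0 - nu = 0,
      posdefmx Lambda,
      forall i, 0 <= lambda i 0
    & forall i, 0 <= theta i 0].

Definition dual_obj (R : realType) (m n : nat) (l u : 'cV[int]_n) (s : int)
    (Lambda : 'M[R]_m) (lambda theta : 'cV[R]_n) (nu : R) : \bar R :=
  (- ldet Lambda +
   (dotv lambda (intvec R u) - dotv theta (intvec R l)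
     + nu * s%:~R - m%:R)%:E)%E.

(* Main.v *)
Require Import Defs.
From mathcomp Require Import all_boot all_order all_algebra.
From mathcomp Require Import all_classical all_reals all_analysis.
From mathcomp Require Import ring lra.
Import Order.TTheory GRing.Theory Num.Theory.
Local Open Scope ring_scope.

(** The bounds are weak duality plus complementary slack.  For positive definite
    [P] and [Q] of order [m], [ln det P + ln det Q <= tr (P Q) - m].  Applied to
    [Lambda] and to the information matrix of the optimal [x], dual feasibility
    turns the trace into [sum_i x_i (lambda_i - theta_i + nu)], whence
    [zeta - LB >= sum_i lambda_i (u_i - x_i) + sum_i theta_i (x_i - l_i)].  Every
    summand is nonnegative, so it is at most the gap [zeta - LB].  The
    inequality itself goes by induction on [m]: one step of Schur reduction on
    [P] and on the accordingly congruent [Q] leaves [ln t <= t - 1]. *)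

Lemma dotvE {R : realType} {n : nat} (x y : 'cV[R]_n) :
  dotv x y = (x^T *m y) 0 0.
Proof. by rewrite /dotv mxE; apply: eq_bigr => i _; rewrite mxE. Qed.

Lemma dotv_col_mx {R : realType} {n1 n2 : nat} (x1 y1 : 'cV[R]_n1)
    (x2 y2 : 'cV[R]_n2) :
  dotv (col_mx x1 x2) (col_mx y1 y2) = dotv x1 y1 + dotv x2 y2.
Proof. by rewrite !dotvE tr_col_mx mul_row_col mxE. Qed.

Lemma posdefmx_dotv_ge0 {R : realType} {m : nat} (X : 'M[R]_m) (z : 'cV[R]_m) :
  posdefmx X -> 0 <= dotv z (X *m z).
Proof.
case=> _ Xp; have [->|/Xp/ltW //] := eqVneq z 0.
by rewrite mulmx0 dotvE mulmx0 mxE.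
Qed.

Lemma posdefmx_congr {R : realType} {m : nat} (G X : 'M[R]_m) :
  G \in unitmx -> posdefmx X -> posdefmx (G^T *m X *m G).
Proof.
move=> Gu [Xs Xp]; split; first by rewrite !trmx_mul trmxK Xs mulmxA.
move=> z z0; have Gz0 : G *m z != 0.
  by apply: contraNneq z0 => Gz; rewrite -(mulKmx Gu z) Gz mulmx0.
by have := Xp _ Gz0; rewrite !dotvE trmx_mul !mulmxA.
Qed.

Lemma posdefmx_block_diag {R : realType} {n1 n2 : nat} (X1 : 'M[R]_n1)
    (X2 : 'M[R]_n2) :
  posdefmx (block_mx X1 0 0 X2) -> posdefmx X1 /\ posdefmx X2.
Proof.
case; rewrite tr_block_mx !trmx0 => /eq_block_mx[s1 _ _ s2] Xp.
split; split=> // z z0.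
  have := Xp (col_mx z 0); rewrite mul_block_col !mul0mx !mulmx0 !addr0.
  rewrite dotv_col_mx [X in _ + X]dotvE mulmx0 mxE addr0; apply.
  by apply: contraNneq z0; rewrite -col_mx0 => /eq_col_mx[->].
have := Xp (col_mx 0 z); rewrite mul_block_col !mul0mx !mulmx0 !add0r.
rewrite dotv_col_mx [X in X + _]dotvE mulmx0 mxE add0r; apply.
by apply: contraNneq z0; rewrite -col_mx0 => /eq_col_mx[_ ->].
Qed.

(** The elimination factor of a Schur step: it has determinant 1, so congruence by it preserves
    determinants. *)
Definition shear_mx {R : realType} {n : nat} (c : 'cV[R]_n) : 'M[R]_(1 + n) :=
  block_mx 1%:M 0 c 1%:M.

Lemma det_shear_mx {R : realType} {n : nat} (c : 'cV[R]_n) :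
  \det (shear_mx c) = 1.
Proof. by rewrite det_lblock !det1 mulr1. Qed.

Lemma shear_mx_unit {R : realType} {n : nat} (c : 'cV[R]_n) :
  shear_mx c \in unitmx.
Proof. by rewrite unitmxE det_shear_mx unitr1. Qed.

Lemma shear_mx_congrE {R : realType} {n : nat} (c : 'cV[R]_n) (a : R)
    (C : 'M[R]_n) :
  shear_mx c *m block_mx a%:M 0 0 C *m (shear_mx c)^T =
  block_mx a%:M (a *: c^T) (a *: c) (a *: (c *m c^T) + C).
Proof.
rewrite /shear_mx tr_block_mx !trmx1 trmx0 !mulmx_block.
rewrite !(mul1mx, mulmx1, mul0mx, mulmx0, addr0, add0r).
by rewrite mul_scalar_mx mul_mx_scalar scalemxAl.
Qed.

(** One pivot of an LDL factorization: [a] is the corner entry, [c] the rest of its column divided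
    by [a], and [C] the Schur complement. *)
Lemma posdefmx_schur {R : realType} {n : nat} (X : 'M[R]_(1 + n)) :
  posdefmx X -> exists (a : R) (c : 'cV[R]_n) (C : 'M[R]_n),
    [/\ 0 < a, posdefmx C &
        X = shear_mx c *m block_mx a%:M 0 0 C *m (shear_mx c)^T].
Proof.
move=> Xpd; have [Xs Xp] := Xpd.
pose a := ulsubmx X 0 0; pose c := a^-1 *: dlsubmx X.
pose C := drsubmx X - a *: (c *m c^T); pose G := shear_mx c.
have a0 : 0 < a.
  (* Testing on the first basis vector reads off the corner entry. *)
  have := Xp (col_mx 1%:M 0); rewrite -{1}[X]submxK mul_block_col.
  rewrite !mulmx0 !addr0 !mulmx1 dotv_col_mx !dotvE trmx0 mul0mx trmx1 mul1mx.
  rewrite [X in _ + X]mxE addr0; apply.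
  by rewrite -col_mx0; apply/eqP => /eq_col_mx[/eqP]; rewrite oner_eq0.
have XE : X = G *m block_mx a%:M 0 0 C *m G^T.
  rewrite shear_mx_congrE addrC subrK -linearZ /= scalerA divff ?gt_eqF//.
  by rewrite scale1r -mx11_scalar trmx_dlsub Xs submxK.
exists a, c, C; split=> //.
have GTu : G^T \in unitmx by rewrite unitmx_tr shear_mx_unit.
(* Undoing the congruence by [G] turns [X] into its block-diagonal core, which is therefore positive
   definite, and so is the block [C]. *)
have /posdefmx_congr/(_ Xpd) : invmx G^T \in unitmx by rewrite unitmx_inv.
rewrite trmx_inv trmxK XE !mulmxA mulVmx ?shear_mx_unit// mul1mx.
rewrite mulmxK //.
by case/posdefmx_block_diag.
Qed.

Lemma det_shear_congr {R : realType} {n : nat} (c : 'cV[R]_n) (a : R)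
    (C : 'M[R]_n) :
  \det (shear_mx c *m block_mx a%:M 0 0 C *m (shear_mx c)^T) = a * \det C.
Proof.
by rewrite !det_mulmx det_tr det_shear_mx mul1r mulr1 det_lblock det_scalar1.
Qed.

Lemma posdefmx_det_gt0 {R : realType} {m : nat} (X : 'M[R]_m) :
  posdefmx X -> 0 < \det X.
Proof.
elim: m X => [|m IH] X; first by rewrite det_mx00.
move=> /(@posdefmx_schur R m)[a [c [C [a0 /IH C0 ->]]]].
by rewrite det_shear_congr mulr_gt0.
Qed.

(** The exponential form of the trace inequality: each Schur step contributes one factor, so the
    induction multiplies bounds. *)
Lemma posdefmx_det_le_expR {R : realType} {m : nat} (P Q : 'M[R]_m) :
  posdefmx P -> posdefmx Q ->
  \det P * \det Q <= expR (\tr (P *m Q) - m%:R).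
Proof.
elim: m P Q => [|m IH] P Q.
  by move=> _ _; rewrite !det_mx00 /mxtrace big_ord0 subr0 expR0 mulr1.
move=> /(@posdefmx_schur R m)[a [c [C [a0 Cp ->]]]] Qp.
set G := shear_mx c.
have [q [d [E [q0 Ep QE]]]] :=
  posdefmx_schur _ (posdefmx_congr G Q (shear_mx_unit c) Qp).
have -> : \det Q = q * \det E.
  rewrite -(det_shear_congr d) -QE !det_mulmx det_tr det_shear_mx.
  by rewrite mulr1 mul1r.
(* By cyclicity of the trace, [G] moves from [P] onto [Q]. The remaining core of [P] is block
   diagonal, so only the diagonal blocks of [G^T *m Q *m G] count. *)
rewrite det_shear_congr -!mulmxA mxtrace_mulC -!mulmxA (mulmxA _ Q).
rewrite QE shear_mx_congrE mulmx_block !mul0mx addr0 add0r mxtrace_block.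
rewrite -scalar_mxM mxtrace_scalar mulmxDr mxtraceD.
have dCd : 0 <= \tr (C *m (q *: (d *m d^T))).
  rewrite -scalemxAr mxtraceZ mulmxA mxtrace_mulC trace_mx11 -dotvE.
  by rewrite mulr_ge0 ?(ltW q0)// posdefmx_dotv_ge0.
have [detC detE] := (posdefmx_det_gt0 _ Cp, posdefmx_det_gt0 _ Ep).
apply: (@le_trans _ _ (expR (a * q - 1) * expR (\tr (C *m E) - m%:R))).
  have aq : a * q <= expR (a * q - 1).
    by have := expR_ge1Dx (a * q - 1); rewrite addrC subrK.
  by rewrite mulrACA ler_pM // ?IH // ltW // mulr_gt0.
by rewrite -expRD ler_expR -natr1 mulr1n; lra.
Qed.

Lemma dotv_info_mx {R : realType} {m n : nat} (v : 'I_n -> 'cV[R]_m)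
    (x : 'I_n -> R) (z : 'cV[R]_m) :
  dotv z ((\sum_i x i *: (v i *m (v i)^T)) *m z) =
  \sum_i x i * dotv (v i) z ^+ 2.
Proof.
rewrite mulmx_suml dotvE mulmx_sumr summxE; apply: eq_bigr => i _.
rewrite -scalemxAl -scalemxAr mxE; congr (_ * _).
rewrite -(mulmxA (v i)) (mulmxA z^T) mxE big_ord1 expr2 -!dotvE; congr (_ * _).
by rewrite /dotv; apply: eq_bigr => j _; rewrite mulrC.
Qed.

(** The quadratic form is a weighted sum of squares. If it is nonpositive at [z], each term
    vanishes, so the matrix kills [z], and nonsingularity gives [z = 0]. *)
Lemma posdefmx_info_mx {R : realType} {m n : nat} (v : 'I_n -> 'cV[R]_m)
    (x : 'I_n -> R) :
  (forall i, 0 <= x i) -> \det (\sum_i x i *: (v i *m (v i)^T)) != 0 ->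
  posdefmx (\sum_i x i *: (v i *m (v i)^T)).
Proof.
move=> x0; set M := \sum_i _ => detM.
have Mu : M \in unitmx by rewrite unitmxE unitfE.
split.
  rewrite /M linear_sum; apply: eq_bigr => i _ /=.
  by rewrite linearZ /= trmx_mul trmxK.
move=> z; apply: contraNT; rewrite -leNgt dotv_info_mx => sum_le0.
have t0 i : true -> 0 <= x i * dotv (v i) z ^+ 2.
  by rewrite mulr_ge0 ?sqr_ge0.
have /eqP := @le_anti _ R _ _ (introT andP (conj sum_le0 (sumr_ge0 _ t0))).
rewrite psumr_eq0 // => /allP xz.
suff Mz : M *m z = 0 by rewrite -(mulKmx Mu z) Mz mulmx0.
rewrite mulmx_suml big1 // => i _.
have := xz i (mem_index_enum i); rewrite mulf_eq0 sqrf_eq0 => /orP[] /eqP e0.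
  by rewrite e0 scale0r mul0mx.
rewrite -scalemxAl -mulmxA [_^T *m z]mx11_scalar -dotvE e0.
by rewrite mul_mx_scalar scale0r scaler0.
Qed.

(** Here [obj] is any real lower bound on the objective at [x], so that a value attained at another
    feasible point can be used at the optimum. *)
Lemma weak_duality_gap {R : realType} {m n : nat} (v : 'I_n -> 'cV[R]_m)
    (l u : 'cV[int]_n) (s : int) (x : 'cV[int]_n) (obj : R) (Lambda : 'M[R]_m)
    (lambda theta : 'cV[R]_n) (nu zeta : R) :
  (forall i, 0 <= l i 0) -> dopt_feasible l u s x -> (obj%:E <= dopt_obj v x)%E ->
  dual_feasible v Lambda lambda theta nu ->
  dual_obj l u s Lambda lambda theta nu = zeta%:E ->
  \sum_i (lambda i 0 * (u i 0 - x i 0)%:~R + theta i 0 * (x i 0 - l i 0)%:~R)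
    <= zeta - obj.
Proof.
move=> l0 [xs xlu] objx [stat Lpd _ _] zetaE.
pose M : 'M[R]_m := \sum_i (x i 0)%:~R *: (v i *m (v i)^T).
have detL := posdefmx_det_gt0 _ Lpd.
have detM : 0 < \det M.
  (* A nonpositive determinant would make the objective [-oo], which no real [obj] bounds from
     below. *)
  rewrite ltNge; apply/negP => M0; move: objx.
  by rewrite /dopt_obj /ldet le0_lneNy ?lee_fin// leeNy_eq.
have Mpd : posdefmx M.
  apply: posdefmx_info_mx; last by rewrite gt_eqF.
  by move=> i; rewrite ler0z (le_trans (l0 i)) //; case/andP: (xlu i).
move: objx; rewrite /dopt_obj /ldet lne_EFin // lee_fin => objx.
move: zetaE; rewrite /dual_obj /ldet lne_EFin // => -[<-].
have key : ln (\det Lambda) + ln (\det M) <= \tr (Lambda *m M) - m%:R.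
  rewrite -lnM ?posrE// -[leRHS]expRK ler_ln ?posrE ?mulr_gt0 ?expR_gt0//.
  exact: posdefmx_det_le_expR.
have trE : \tr (Lambda *m M) =
    \sum_i (x i 0)%:~R * (lambda i 0 - theta i 0 + nu).
  rewrite mulmx_sumr raddf_sum; apply: eq_bigr => i _ /=.
  rewrite -scalemxAr mxtraceZ; congr (_ * _); have := stat i.
  by rewrite /mxinner (proj1 Lpd); lra.
(* The slack sum is the linear part of the dual objective minus the trace, once [s] is expanded as
   the sum of the [x i 0]; [key] then bounds the trace from below. *)
suff -> : \sum_i (lambda i 0 * (u i 0 - x i 0)%:~R
      + theta i 0 * (x i 0 - l i 0)%:~R) =
    dotv lambda (intvec R u) - dotv theta (intvec R l) + nu * s%:~R
      - \tr (Lambda *m M) by lra.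
rewrite trE /dotv -xs rmorph_sum mulr_sumr -!sumrB -big_split -sumrB /=.
by apply: eq_bigr => i _; rewrite !mxE !rmorphB /=; ring.
Qed.

Theorem theorem1 (R : realType) (m n : nat) (hm : (0 < m)%N) (hn : (0 < n)%N)
    (v : 'I_n -> 'cV[R]_m) (hA : \rank (design_mx v) = m)
    (l u : 'cV[int]_n) (hl : forall i, 0 <= l i 0)
    (hlu : forall i, l i 0 < u i 0)
    (s : int) (hsm : m%:Z <= s)
    (hls : \sum_(i < n) l i 0 <= s) (hsu : s <= \sum_(i < n) u i 0)
    (LB : R)
    (hLB : exists x : 'cV[int]_n,
        dopt_feasible l u s x /\ dopt_obj v x = LB%:E)
    (Lambda : 'M[R]_m) (lambda theta : 'cV[R]_n) (nu zeta : R)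
    (hdual : dual_feasible v Lambda lambda theta nu)
    (hzeta : dual_obj l u s Lambda lambda theta nu = zeta%:E)
    (xstar : 'cV[int]_n) (hopt : dopt_optimal v l u s xstar) :
  (forall k, 0 < theta k 0 ->
     xstar k 0 <= l k 0 + Num.floor ((zeta - LB) / theta k 0)) /\
  (forall k, 0 < lambda k 0 ->
     xstar k 0 >= u k 0 - Num.floor ((zeta - LB) / lambda k 0)).
Proof.
have [[_ xlu] xbest] := hopt; have [y [yf yLB]] := hLB.
have LBx : (LB%:E <= dopt_obj v xstar)%E by rewrite -yLB xbest.
have gap := weak_duality_gap _ _ _ _ _ _ _ _ _ _ _ hl hopt.1 LBx hdual hzeta.
have [_ _ lam0 th0] := hdual.
have tl i : 0 <= theta i 0 * (xstar i 0 - l i 0)%:~R.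
  by rewrite mulr_ge0 // ler0z subr_ge0; case/andP: (xlu i).
have tu i : 0 <= lambda i 0 * (u i 0 - xstar i 0)%:~R.
  by rewrite mulr_ge0 // ler0z subr_ge0; case/andP: (xlu i).
have termk k : lambda k 0 * (u k 0 - xstar k 0)%:~R
    + theta k 0 * (xstar k 0 - l k 0)%:~R <= zeta - LB.
  apply: le_trans gap; rewrite (bigD1 k) //= lerDl sumr_ge0 // => i _.
  by rewrite addr_ge0.
(* Drop the other multiplier's term and divide by the positive one. The slack of [xstar k 0] is an
   integer, so the real quotient may be replaced by its floor. *)
split=> k k0.
  rewrite -lerBlDl floor_ge_int ler_pdivlMr // mulrC.
  by apply: le_trans (termk k); rewrite lerDr.
rewrite lerBlDr -lerBlDl floor_ge_int ler_pdivlMr // mulrC.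
by apply: le_trans (termk k); rewrite lerDl.
Qed.
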